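(* For every $\omega\in\Omega_b$, $m_\infty(M(\omega))=0$.
   Context: Here $\mathbb N=\{1,2,3,\dots\}$. Generalized Cantor set. For $\omega=(q_n)_{n=1}^\infty\in(0,1)^{\mathbb N}$, put $I=[0,1]$. Remove from $I$ an open interval $J_1$ of length $q_1$ so that $I\setminus J_1$ consists of two closed intervals $I_1^1,I_1^2$ of the same length; let $E_1=I_1^1\cup I_1^2$. Inductively, given $E_k=\bigcup_{i=1}^{2^k}I_k^i$ (a union of $2^k$ disjoint closed intervals of the same length), remove from each $I_k^i$ an open interval of length $|I_k^i|q_{k+1}$ (where $|J|$ denotes the length of an interval $J$) so that the remainder $E_{k+1}$ consists of $2^{k+1}$ closed intervals of the same length (i.e. the removed open interval is centered at the midpoint of $I_k^i$). Then $E(\omega)=\bigcap_{k=1}^\infty E_k\subset[0,1]\subset\mathbb C$. Moduli space. Two generalized Cantor sets $E(\omega_1),E(\omega_2)$ are quasiconformally equivalent if there exists a quasiconformal mapping $\varphi:\mathbb C\to\mathbb C$ with $\varphi(E(\omega_1))=E(\omega_2)$. The moduli space $M(\omega)$ of $\omega$ is the set of $\omega'\in(0,1)^{\mathbb N}$ such that $E(\omega')$ is quasiconformally equivalent to $E(\omega)$. $\Omega_b\subset(0,1)^{\mathbb N}$ is the set of $\omega=(q_n)_{n=1}^\infty$ such that $\sup_{n\in\mathbb N}q_n<1$. $m_\infty$ is the standard product probability measure on $(0,1)^{\mathbb N}$ formed from the Lebesgue measure on $(0,1)$. *)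

(* Defs.v *)
(* MathComp-Analysis. *)
From HB Require Import structures.
From mathcomp Require Import all_boot all_order all_algebra.
From mathcomp Require Import complex.
From mathcomp Require Import all_classical all_reals all_analysis.

Set Implicit Arguments.
Unset Strict Implicit.
Unset Printing Implicit Defensive.

Import Order.TTheory GRing.Theory Num.Theory.
Import numFieldTopology.Exports numFieldNormedType.Exports.

Local Open Scope classical_set_scope.
Local Open Scope ring_scope.

(* Throughout, a sequence (q_n)_{n >= 1} is a function w : nat -> R with
   q_(n+1) = w n. *)

Definition seq01 (R : realType) : set (nat -> R) :=
  [set w | forall n, 0 < w n < 1].

Section GeneralizedCantorSet.
Variable R : realType.

(* A pair (a, b) encodes the closed interval [a, b]. What is removed is the
   open interval of length q * (b - a) centered at the midpoint. *)
Definition split_itv (q : R) (J : R * R) : seq (R * R) :=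
  let mid := (J.1 + J.2) / 2 in
  let h := q * (J.2 - J.1) / 2 in
  [:: (J.1, mid - h); (mid + h, J.2)].

Fixpoint cantor_itvs (w : nat -> R) (k : nat) : seq (R * R) :=
  if k is k'.+1 then flatten [seq split_itv (w k') J | J <- cantor_itvs w k']
  else [:: (0, 1)].

Definition cantor_level (w : nat -> R) (k : nat) : set R :=
  [set x | exists2 J, J \in cantor_itvs w k & J.1 <= x <= J.2].

Definition cantor_set (w : nat -> R) : set R :=
  \bigcap_(k in [set k | (0 < k)%N]) cantor_level w k.

End GeneralizedCantorSet.

(* The structure of numFieldType gives access to the norm topology of the
   complex plane. *)
Definition Cplx (R : realType) : numFieldType := R[i]%C.

Section Quasiconformal.
Variable R : realType.
Local Notation C := (Cplx R).

(* Euclidean distance, as a real number. *)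
Definition distC (z w : C) : R := ComplexField.Normc.normc (z - w).

Definition homeomorphism (f : C -> C) : Prop :=
  continuous f /\ exists g : C -> C, [/\ continuous g, cancel f g & cancel g f].

(* For continuous f both are attained, and for injective f and r > 0 the
   minimum is positive. *)
Definition max_stretch (f : C -> C) (z : C) (r : R) : R :=
  sup [set distC (f w) (f z) | w in [set w | distC w z = r]].

Definition min_stretch (f : C -> C) (z : C) (r : R) : R :=
  inf [set distC (f w) (f z) | w in [set w | distC w z = r]].

Definition linear_dilatation (f : C -> C) (z : C) : \bar R :=
  limf_esup (fun r => (max_stretch f z r / min_stretch f z r)%:E) (0 : R)^'+.

(* Metric definition of quasiconformality. Orientation-reversing maps are
   allowed; since the sets [cantor_set w] are invariant under complex
   conjugation, requiring f to preserve the orientation would not change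
   [qc_equivalent] on them. *)
Definition quasiconformal (f : C -> C) : Prop :=
  homeomorphism f /\
  exists H : R, forall z : C, (linear_dilatation f z <= H%:E)%E.

Definition real_in_C (A : set R) : set C := [set x%:C%C | x in A].

Definition qc_equivalent (A B : set C) : Prop :=
  exists f : C -> C, quasiconformal f /\ f @` A = B.

End Quasiconformal.

Definition moduli_space (R : realType) (w : nat -> R) : set (nat -> R) :=
  [set w' | seq01 w' /\
    qc_equivalent (real_in_C (cantor_set w')) (real_in_C (cantor_set w))].

(* For w in seq01, [range w] is nonempty and bounded, so [sup] is the
   supremum. *)
Definition Omega_b (R : realType) : set (nat -> R) :=
  [set w | seq01 w /\ sup (range w) < 1].

Definition coordinate_events (R : realType) : set (set (nat -> R)) :=
  [set A | exists n (B : set R), measurable B /\ A = [set w | B (w n)]].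

(* The space of real sequences with the product of the Borel sigma-algebras. *)
Definition seqR (R : realType) :
    measurableType (sigma_display (@coordinate_events R)) :=
  g_sigma_algebraType (@coordinate_events R).

(* m is the product of countably many copies of the Lebesgue measure on ]0, 1[,
   seen as a probability measure on the space of all real sequences that is
   carried by seq01. These values on rectangles determine m uniquely. *)
Definition is_product_lebesgue01 (R : realType)
    (m : probability (seqR R) R) : Prop :=
  forall (n : nat) (B : nat -> set R), (forall i, measurable (B i)) ->
    m [set w : seqR R | forall i, (i < n)%N -> B i (w i)] =
    (\prod_(i < n) (@lebesgue_measure R) (B i `&` `]0%R, 1%R[))%E.

(* Main.v *)
(* Uniform perfectness is a quasiconformal invariant.

   If w' is not bounded away from 1, then the complement of E(w') contains
   annuli centered at 0 of arbitrarily large modulus which separate two parts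
   of E(w'): the leftmost interval of level n has a relatively huge middle gap.
   If a quasiconformal f maps E(w') onto E(w) with sup w = q < 1, pass down the
   binary tree of intervals of E(w) to a smallest interval that meets the images
   of both parts. Its children [p, y] and [b, _] each meet one image only, and
   |y - p| / |b - p| >= (1 - q) / (1 + q). This contradicts a length-area bound:
   if the preimages of p and of the point y of the segment [p, b] lie in the
   bounded complementary component of the annulus s < |z| < 8^N s, and that of b
   in the unbounded one, then N (|y - p| / |b - p|)^2 <= M(f).

   For the bound, every circle in the annulus contains points w realizing each
   value of |f(w) - b| in [|b - y|, |b - p|]. Cover a disc by balls 3B_i with
   B_i = B(z_i, r_i) disjoint and small. The image of 3B_i has radius o_i, the
   image of B_i contains a disc of radius l_i, so |y - p| <= 2 sum o_i over the
   balls 3B_i meeting a given circle. Integrate over the radii in [8^k s, 2 8^k s]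
   and apply Cauchy-Schwarz: since sum r_i^2 and sum l_i^2 are bounded by areas,
   each k < N takes up a definite share of the area of B(b, 3 |b - p|).

   Hence almost every w', being a sequence of independent uniform variables, lies
   outside the moduli space. *)
Require Import Defs.
From mathcomp Require Import all_boot all_order all_algebra.
From mathcomp Require Import finmap complex.
From mathcomp Require Import all_classical all_reals all_analysis.
From mathcomp Require Import measurable_realfun.
From mathcomp Require Import ring lra.

Set Implicit Arguments.
Unset Strict Implicit.
Unset Printing Implicit Defensive.

Import Order.TTheory GRing.Theory Num.Theory.
Import numFieldTopology.Exports numFieldNormedType.Exports.

Local Open Scope classical_set_scope.
Local Open Scope ring_scope.

(** * The plane *)

Section Plane.
Variable R : realType.
Local Notation C := (Cplx R).
Implicit Types (x y z : C) (t : R).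

Lemma distCC z : distC z z = 0.
Proof. by rewrite /distC subrr ComplexField.Normc.normc0. Qed.

Lemma distC_sym z y : distC z y = distC y z.
Proof. by rewrite /distC -[LHS]normcN opprB. Qed.

Lemma distC_triangle y x z : distC x z <= distC x y + distC y z.
Proof.
rewrite /distC -[x - z](subrKA y).
exact: le_normcD.
Qed.

Lemma distC_ge0 z y : 0 <= distC z y.
Proof. by rewrite /distC; case: (z - y) => a b /=; exact: sqrtr_ge0. Qed.

Lemma distC_gt0 z y : z != y -> 0 < distC z y.
Proof.
move=> zy; rewrite lt_neqAle distC_ge0 andbT eq_sym.
apply: contra zy => /eqP /ComplexField.Normc.eq0_normc /eqP.
by rewrite subr_eq0.
Qed.

Definition line_pt (p v : C) (t : R) : C := p + (t%:C)%C * v.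

Lemma distC_line_pt p v s t :
  distC (line_pt p v s) (line_pt p v t) = `|s - t| * distC v 0.
Proof.
rewrite /distC /line_pt subr0 opprD addrACA subrr add0r -mulrBl.
rewrite ComplexField.Normc.normcM -rmorphB; congr (_ * _).
by rewrite /= expr0n addr0 sqrtr_sqr.
Qed.

(** The norm of a [numFieldType] takes values in the field itself; this identity translates the
    topology of the plane into terms of the real-valued [distC]. *)
Lemma normC_distC z y : `|z - y| = ((distC z y)%:C)%C :> C.
Proof. by []. Qed.

Lemma continuous_distCP (f : C -> C) : continuous f <->
  forall z e, 0 < e ->
    exists2 d, 0 < d & forall y, distC y z < d -> distC (f y) (f z) < e.
Proof.
split=> [cf z e e0|H z].
  have /cvgrPdist_lt/(_ ((e%:C)%C)) := cf z.
  rewrite ltcR => /(_ e0) /nbhs_ballP[d /= d0 H].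
  exists (complex.Re d) => [|y yd].
    by move: d0; case: d {H} => a b; rewrite ltcE => /andP[].
  have := H y; rewrite /ball/= !normC_distC distC_sym (distC_sym (f z)) !ltcR.
  apply; move: d0 yd {H}; case: d => a b; rewrite !ltcE /= => /andP[/eqP -> _] ->.
  by rewrite eqxx.
apply/(@cvgrPdist_lt _ _ _ _ (nbhs_filter z)) => -[a b].
rewrite ltcE /= => /andP[/eqP -> a0].
have [d d0 Hd] := H z a a0.
apply/nbhs_ballP; exists ((d%:C)%C); first by rewrite /= ltcR.
move=> y; rewrite /ball/= !normC_distC ltcR distC_sym => /Hd.
by rewrite distC_sym -ltcR.
Qed.

Lemma line_pt_continuous p v (f : C -> C) z : continuous f ->
  continuous (fun t => distC (f (line_pt p v t)) z).
Proof.
move=> /continuous_distCP cf t; apply/cvgrPdist_lt => e e0.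
have [d d0 fd] := cf (line_pt p v t) e e0.
have v1 : 0 < distC v 0 + 1 by rewrite ltr_wpDl ?distC_ge0.
apply/nbhs_ballP; exists (d / (distC v 0 + 1)); first by rewrite /= divr_gt0.
move=> s /=; rewrite /ball/= ltr_pdivlMr// => std.
have /fd : distC (line_pt p v s) (line_pt p v t) < d.
  rewrite distC_line_pt distrC; apply: le_lt_trans std.
  by rewrite ler_wpM2l// lerDl.
apply: le_lt_trans; rewrite ler_norml.
have := distC_triangle (f (line_pt p v t)) (f (line_pt p v s)) z.
have := distC_triangle (f (line_pt p v s)) (f (line_pt p v t)) z.
rewrite (distC_sym (f (line_pt p v t)) (f (line_pt p v s))).
by move=> ? ?; apply/andP; split; lra.
Qed.

Lemma path_crossing p v (f : C -> C) z (a b t : R) : continuous f -> a <= b ->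
  distC (f (line_pt p v a)) z <= t <= distC (f (line_pt p v b)) z ->
  exists2 c, a <= c <= b & distC (f (line_pt p v c)) z = t.
Proof.
move=> cf ab tab.
have := @IVT R (fun t => distC (f (line_pt p v t)) z) a b t ab.
case=> [||c cab <-].
- exact/continuous_subspaceT/line_pt_continuous.
- have /andP[h1 h2] := tab.
  by rewrite ge_min le_max h1 h2 orbT.
- by exists c => //; move: cab; rewrite in_itv.
Qed.

Lemma distC_ReIm z y : `|complex.Re z - complex.Re y| <= distC z y /\
  `|complex.Im z - complex.Im y| <= distC z y /\
  distC z y <= `|complex.Re z - complex.Re y| + `|complex.Im z - complex.Im y|.
Proof.
rewrite /distC; case: z => a b; case: y => c d /=.
have := sqr_ge0 (a - c); have := sqr_ge0 (b - d) => h1 h2.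
split; [|split].
- by rewrite -sqrtr_sqr ler_sqrt ?addr_ge0// lerDl.
- by rewrite -sqrtr_sqr ler_sqrt ?addr_ge0// lerDr.
- rewrite -[leRHS]ger0_norm ?addr_ge0// -[leRHS]sqrtr_sqr ler_sqrt ?sqr_ge0//.
  have := mulr_ge0 (normr_ge0 (a - c)) (normr_ge0 (b - d)).
  have := real_normK (num_real (a - c)); have := real_normK (num_real (b - d)).
  by rewrite (sqrrD `|_|) mulr2n => -> -> ?; lra.
Qed.

(** The disc lies in a square, compact as the continuous image of a product of two segments. The
    radii may vary arbitrarily with the centre, and the centres in [s] may lie outside the disc. *)
Lemma disc_finite_cover (z0 : C) (M : R) (r : C -> R) : (forall z, 0 < r z) ->
  exists s : seq C, forall z, distC z z0 <= M ->
    exists2 c, c \in s & distC z c < r c.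
Proof.
move=> r0.
pose h (u : R * R) : C := Complex u.1 u.2.
have h_cont : continuous h.
  move=> u; apply/(@cvgrPdist_lt _ _ _ _ (nbhs_filter u)) => -[a b].
  rewrite ltcE /= => /andP[/eqP -> a0].
  apply/nbhs_ballP; exists (a / 2); first by rewrite /= divr_gt0.
  case: u => x y; case=> x' y' [/= bx by'].
  rewrite -[0]/(complex.Im (a%:C)%C) normC_distC ltcR.
  apply: le_lt_trans (distC_ReIm _ _).2.2 _ => /=.
  by move: bx by'; rewrite /ball/= => ? ?; lra.
have cK : compact (h @` ([set` `[complex.Re z0 - M, complex.Re z0 + M]] `*`
                   [set` `[complex.Im z0 - M, complex.Im z0 + M]])).
  apply: continuous_compact; first exact: continuous_subspaceT.
  by apply: compact_setX; exact: segment_compact.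
rewrite compact_cover in cK.
have [||D _ DK] := cK C setT (fun c => [set z | distC z c < r c]).
- move=> c _; rewrite openE => u /= uc; rewrite /interior.
  apply/nbhs_ballP; exists ((r c - distC u c)%:C)%C.
    by rewrite /= ltcR subr_gt0.
  move=> u'; rewrite /ball/= normC_distC ltcR distC_sym => u'u.
  by have := distC_triangle u u' c; lra.
- by move=> u _; exists u => //=; rewrite distCC.
exists (enum_fset D) => z zM; have [h1 [h2 _]] := distC_ReIm z z0.
have [|c cD /= zc] := DK z; last by exists c.
exists (complex.Re z, complex.Im z); last by rewrite /h/=; case: (z).
split=> /=; rewrite in_itv/=; move: (le_trans h1 zM) (le_trans h2 zM);
  rewrite !ler_norml => /andP[? ?] /andP[? ?]; apply/andP; split; lra.
Qed.

End Plane.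

(** * Covering and area *)

Section Covering.
Variable R : realType.
Local Notation C := (Cplx R).

(** Greedy selection, larger discs first: the list is sorted increasingly and the induction treats
    its tail first. A disc rejected for meeting a selected one is no larger, hence lies in the
    threefold enlargement of the latter. *)
Lemma vitali_disc_cover (r : C -> R) (s : seq C) : exists D : seq C,
  [/\ uniq D, {subset D <= s},
      forall c c' x, c \in D -> c' \in D -> distC x c < r c ->
        distC x c' < r c' -> c = c' &
      forall x c, c \in s -> distC x c < r c ->
        exists2 c', c' \in D & distC x c' < 3 * r c'].
Proof.
wlog : s / sorted (fun c c' => r c <= r c') s.
  set le := (fun c c' => r c <= r c').
  have : sorted le (sort le s) by apply: sort_sorted => x y; exact: le_total.
  move=> /[swap] /[apply] -[D [uD Ds Dd cD]]; exists D; split => //.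
  - by move=> x /Ds; rewrite mem_sort.
  - by move=> x c cs; apply: cD; rewrite mem_sort.
elim: s => [_|i s IH /= iss]; first by exists [::].
have les : {in s, forall c, r i <= r c}.
  have tr : transitive (fun c c' => r c <= r c').
    by move=> x y z; exact: le_trans.
  by have /allP := order_path_min tr iss.
have [D [uD Ds Dd cD]] := IH (path_sorted iss).
have [[j jD [x [xi xj]]]|H] := pselect (exists2 j, j \in D &
    exists x, distC x i < r i /\ distC x j < r j).
  exists D; split => // [c /Ds|y c]; first by rewrite inE orbC => ->.
  rewrite inE => /predU1P[-> yi|]; last exact: cD.
  exists j => //; have := les _ (Ds _ jD).
  have := distC_triangle i y j; have := distC_triangle x i j.
  by rewrite (distC_sym i x); lra.
have H' j x : j \in D -> distC x i < r i -> distC x j < r j -> False.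
  by move=> jD xi xj; apply: H; exists j => //; exists x.
have [iD|iD] := boolP (i \in D).
  exists D; split => // [c /Ds|y c]; first by rewrite inE orbC => ->.
  rewrite inE => /predU1P[-> yi|]; last exact: cD.
  by exists i => //; have := distC_ge0 y i; lra.
exists (i :: D); split => [|c|c c' x|y c]; first by rewrite /= iD.
- by rewrite !inE => /predU1P[->|/Ds ->]; rewrite ?eqxx ?orbT.
- rewrite !inE => /predU1P[->|cD'] /predU1P[->|cD''] // h1 h2.
  + by have := H' _ _ cD'' h1 h2.
  + by have := H' _ _ cD' h2 h1.
  + exact: Dd h1 h2.
- rewrite inE => /predU1P[-> yi|cs /(cD _ _ cs)[j jD yj]].
    by exists i; rewrite ?inE ?eqxx//; have := distC_ge0 y i; lra.
  by exists j => //; rewrite inE jD orbT.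
Qed.

(** Integrate over []a, b[] the sum of the [k i] times the indicators of [[c i - o i, c i + o i]].
    This serves with unit weights along one circle and with weights [2 * o i] over the radii of
    circles. *)
Lemma weighted_interval_cover (I : Type) (s : seq I) (c o k : I -> R) (a b d : R) :
  a <= b -> 0 <= d -> (forall i, 0 <= o i) -> (forall i, 0 <= k i) ->
  (forall x, a < x < b -> d <= \sum_(i <- s | `|x - c i| <= o i) k i) ->
  d * (b - a) <= \sum_(i <- s) k i * (2 * o i).
Proof.
move=> ab d0 o0 k0 H.
pose J i := `[c i - o i, c i + o i]%classic.
pose D := `]a, b[%classic : set R.
have mu_itv (x y : R) : x <= y -> (lebesgue_measure `[x, y]%classic = (y - x)%:E)%E.
  move=> xy; rewrite lebesgue_measure_itv/= lte_fin -EFinB; case: ltP => // yx.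
  by rewrite (@le_anti _ _ x y) ?xy// subrr.
have mD : measurable (D : set (measurableTypeR R)) by exact: measurable_itv.
have muD : lebesgue_measure D = (b - a)%:E.
  rewrite lebesgue_measure_itv/= lte_fin -EFinB; case: ltP => // ba.
  by rewrite (@le_anti _ _ a b) ?ab// subrr.
rewrite -lee_fin EFinM -muD; rewrite -integral_cst//.
apply: (@le_trans _ _ (\int[lebesgue_measure]_(x in D)
    (\sum_(i <- s) (k i * \1_(J i) x)%:E)%E)%E).
  apply: ge0_le_integral => //=.
  - apply: emeasurable_sum => i; apply/measurable_EFinP.
    by apply: measurable_funM => //; apply: measurable_indic; exact: measurable_itv.
  - move=> x; rewrite /D/= in_itv/= => xD; rewrite sumEFin lee_fin.
    apply: le_trans (H _ xD) _.
    rewrite big_mkcond/=; apply: ler_sum => i _; rewrite indicE.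
    case: ifP => [xi|_]; last by rewrite mulr_ge0.
    rewrite mem_set ?mulr1// /J/= in_itv/=.
    by move: xi; rewrite ler_norml => /andP[? ?]; apply/andP; split; lra.
rewrite ge0_integral_sum//; last 2 first.
- move=> i; apply/measurable_EFinP.
  by apply: measurable_funM => //; apply: measurable_indic; exact: measurable_itv.
- by move=> i x _; rewrite lee_fin mulr_ge0.
rewrite -sumEFin; apply: lee_sum => i _.
under eq_integral do rewrite EFinM.
rewrite ge0_integralZl//; last 2 first.
- by apply/measurable_EFinP; apply: measurable_indic; exact: measurable_itv.
- by rewrite lee_fin.
rewrite integral_indic//; last exact: measurable_itv.
rewrite EFinM lee_wpmul2l ?lee_fin//.
apply: (@le_trans _ _ (lebesgue_measure (J i))).
  apply: le_measure; rewrite ?inE//; last exact: measurable_itv.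
  by apply: measurableI => //; exact: measurable_itv.
by rewrite mu_itv ?lee_fin; have := o0 i; lra.
Qed.

(** Open squares of side [r i] inside the discs are disjoint and lie in a square of side [2 * M];
    only product measures of squares are compared. *)
Lemma disjoint_discs_area (I : choiceType) (s : seq I) (c : I -> C) (r : I -> R)
    (z0 : C) (M : R) : uniq s -> 0 <= M -> (forall i, i \in s -> 0 <= r i) ->
  (forall i j x, i \in s -> j \in s -> distC x (c i) < r i ->
     distC x (c j) < r j -> i = j) ->
  (forall i x, i \in s -> distC x (c i) < r i -> distC x z0 < M) ->
  \sum_(i <- s) r i ^+ 2 <= 4 * M ^+ 2.
Proof.
move=> us M0 r0 dis inM.
pose Q (z : C) (h : R) : set (measurableTypeR R * measurableTypeR R) :=
  `]complex.Re z - h, complex.Re z + h[%classic `*`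
  `]complex.Im z - h, complex.Im z + h[%classic.
have mQ z h : measurable (Q z h) by apply: measurableX; exact: measurable_itv.
pose mu := (@lebesgue_measure R \x @lebesgue_measure R)%E.
have muI (x h : R) : 0 <= h ->
    lebesgue_measure (`]x - h, x + h[%classic : set R) = (2 * h)%:E.
  move=> h0; rewrite lebesgue_measure_itv/= lte_fin -EFinB; case: ltP => // hh.
    by congr (_%:E); ring.
  by rewrite (@le_anti _ _ h 0) ?mulr0//; apply/andP; split; lra.
have muQ z h : 0 <= h -> mu (Q z h) = ((2 * h) ^+ 2)%:E.
  move=> h0; rewrite /mu product_measure1E; try exact: measurable_itv.
  by rewrite expr2 EFinM; congr (_ * _)%E; exact: muI.
have QP (z : C) h (x y : R) : Q z h (x, y) <->
    `|x - complex.Re z| < h /\ `|y - complex.Im z| < h.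
  rewrite /Q/= !in_itv/= !ltr_norml.
  by split=> -[/andP[? ?] /andP[? ?]]; split; apply/andP; split; lra.
rewrite -lee_fin -sumEFin.
have -> : \sum_(i <- s) (r i ^+ 2)%:E = \sum_(i <- s) mu (Q (c i) (r i / 2)).
  apply: eq_big_seq => j js; rewrite muQ ?divr_ge0 ?r0//; congr (_%:E); by field.
have inQ i x y : Q (c i) (r i / 2) (x, y) -> distC (Complex x y : C) (c i) < r i.
  move=> /QP[h1 h2]; apply: le_lt_trans (distC_ReIm _ _).2.2 _ => /=; lra.
apply: (@le_trans _ _ (mu (Q z0 M))); last first.
  by rewrite muQ// lee_fin le_eqVlt; apply/orP; left; apply/eqP; ring.
rewrite fsbig_seq// -measure_fin_bigcup//; last first.
- move=> i j /= si sj [[x y] [Qi Qj]].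
  exact: dis si sj (inQ _ _ _ Qi) (inQ _ _ _ Qj).
apply: le_measure; rewrite ?inE//.
  by apply: fin_bigcup_measurable.
move=> [x y] [i /= si /inQ /(inM _ _ si) xM]; apply/QP.
have := distC_ReIm (Complex x y : C) z0 => /= -[h1 [h2 _]].
by split; apply: le_lt_trans xM.
Qed.
End Covering.

(** * Quasiconformal maps on small discs *)

Section Homeomorphism.
Variable R : realType.
Local Notation C := (Cplx R).
Implicit Types (p v z w : C).

Lemma distC_line_pt0 p v (t : R) : 0 <= t ->
  distC (line_pt p v t) p = t * distC v 0.
Proof.
move=> t0; have := distC_line_pt p v t 0.
rewrite subr0 ger0_norm// => <-; congr distC.
by rewrite /line_pt mul0r addr0.
Qed.

Definition sphere_pt z (r : R) : C := line_pt z 1 r.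

Lemma distC_sphere_pt z r : 0 <= r -> distC (sphere_pt z r) z = r.
Proof.
move=> r0; rewrite /sphere_pt distC_line_pt0// /distC subr0.
by rewrite ComplexField.Normc.normc1 mulr1.
Qed.

Lemma continuous_disc_bounded (f : C -> C) z (M : R) : continuous f ->
  exists K, forall w, distC w z <= M -> distC (f w) (f z) <= K.
Proof.
move=> /continuous_distCP cf.
have /choice[r rP] : forall c, exists r, 0 < r /\
    forall w, distC w c < r -> distC (f w) (f c) < 1.
  by move=> c; have [d d0 fd] := cf c 1 ltr01; exists d.
have [s sP] := disc_finite_cover z M (fun c => (rP c).1).
exists (\sum_(c <- s) (1 + distC (f c) (f z))) => w /sP[c cs /(rP c).2 wc].
have := distC_triangle (f c) (f w) (f z).
have : 1 + distC (f c) (f z) <= \sum_(c <- s) (1 + distC (f c) (f z)).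
  rewrite (big_rem c)//= lerDl sumr_ge0// => i _.
  by rewrite addr_ge0// distC_ge0.
lra.
Qed.

Variables f g : C -> C.
Hypotheses (cf : continuous f) (cg : continuous g).
Hypotheses (fK : cancel f g) (gK : cancel g f).

(** [f] is bounded on the disc of radius [t] about [z], so the image of the ray under [g] must leave
    this disc. *)
Lemma ray_crossing p v z (a t : R) : v != 0 ->
  distC (g (line_pt p v a)) z <= t ->
  exists2 c, a <= c & distC (g (line_pt p v c)) z = t.
Proof.
move=> v0 at_.
have [K KP] := continuous_disc_bounded z t cf.
(* The point with this parameter is at distance [K + 1 + distC (f z) (line_pt p v a)] from the start
   of the ray, hence farther than [K] from [f z]. *)
pose b := a + (K + 1 + distC (f z) (line_pt p v a)) / distC v 0.
have dv0 : 0 < distC v 0 := distC_gt0 v0.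
have K0 : 0 <= K by apply: le_trans (KP _ at_); exact: distC_ge0.
have ab : a <= b by rewrite lerDl divr_ge0 ?addr_ge0 ?distC_ge0.
have [|c /andP[ac _] <-] := @path_crossing _ p v _ z a b t cg ab; last by exists c.
rewrite at_/= leNgt; apply/negP => /ltW /KP; rewrite gK.
have := distC_line_pt p v b a; rewrite ger0_norm ?subr_ge0//.
rewrite [X in X * _](_ : _ = (K + 1 + distC (f z) (line_pt p v a)) / distC v 0);
  last by rewrite /b addrC addKr.
rewrite divfK ?gt_eqF//.
have := distC_triangle (f z) (line_pt p v b) (line_pt p v a).
by rewrite -/b => *; lra.
Qed.

(** Prolong the segment from [f z] to [f w] beyond [f w]: the preimage of the prolongation meets the
    circle of radius [r]. *)
Lemma sphere_dominates_disc z w (r : R) : distC w z <= r ->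
  exists2 w', distC w' z = r & distC (f w) (f z) <= distC (f w') (f z).
Proof.
move=> wr; have [->|wz] := eqVneq w z.
  exists (sphere_pt z r); last by rewrite distCC distC_ge0.
  by rewrite distC_sphere_pt// (le_trans (distC_ge0 w z)).
have lw : line_pt (f z) (f w - f z) 1 = f w by rewrite /line_pt mul1r addrC subrK.
have [||c c1 cr] := @ray_crossing (f z) (f w - f z) z 1 r.
- by rewrite subr_eq0 (can_eq fK).
- by rewrite lw fK.
exists (g (line_pt (f z) (f w - f z) c)) => //.
rewrite gK -{1}lw !distC_line_pt0 ?(le_trans _ c1)//.
by rewrite ler_wpM2r// distC_ge0.
Qed.

(** Otherwise the preimage of the segment from [f z] to [y] would meet the circle at a point whose
    image is closer than [l] to [f z]. *)
Lemma image_disc_contains_disc z y (r l : R) : 0 < r ->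
  (forall w, distC w z = r -> l <= distC (f w) (f z)) ->
  distC y (f z) < l -> distC (g y) z < r.
Proof.
move=> r0 lP yl; rewrite ltNge; apply/negP => ry.
have l0 : line_pt (f z) (y - f z) 0 = f z by rewrite /line_pt mul0r addr0.
have l1 : line_pt (f z) (y - f z) 1 = y by rewrite /line_pt mul1r addrC subrK.
have [|c /andP[c0 c1] /lP] := @path_crossing _ (f z) (y - f z) g z 0 1 r cg ler01.
  by rewrite l0 l1 fK distCC ltW.
rewrite gK distC_line_pt0//.
have : distC y (f z) = distC (y - f z) 0 by rewrite /distC subr0.
have := distC_ge0 (y - f z) 0; nra.
Qed.

(** An upper limit below [|H| + 1] yields an inequality at all small radii, with a constant that is
    at least 1. *)
Lemma dilatation_bound (H : R) z : (linear_dilatation f z <= H%:E)%E ->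
  exists2 r0, 0 < r0 & forall r w w', 0 < r < r0 -> distC w z = r ->
    distC w' z = r -> distC (f w) (f z) <= (`|H| + 1) * distC (f w') (f z).
Proof.
move=> dH.
have : (linear_dilatation f z < (`|H| + 1)%:E)%E.
  by apply: le_lt_trans dH _; rewrite lte_fin; have := ler_norm H; lra.
rewrite /linear_dilatation /limf_esup => /ereal_inf_lt[_ [V V0 <-]] VH.
have /continuous_distCP/(_ z 1 ltr01)[d1 d10 fd1] := cf.
have [e /= e0 eV] := V0.
exists (Num.min e d1); first by rewrite lt_min e0.
move=> r w w' /andP[r0]; rewrite lt_min => /andP[re rd] wr w'r.
have Vr : V r.
  by apply: eV => //=; rewrite sub0r normrN gtr0_norm.
have := le_lt_trans (ereal_sup_ubound (imageP _ Vr)) VH; rewrite lte_fin.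
(* Continuity of [g] keeps the image of the circle at distance at least [d2] from [f z], so the
   infimum is positive and the quotient is genuine. *)
have /continuous_distCP/(_ (f z) r r0)[d2 d20 gd2] := cg.
have sup_w : distC (f w) (f z) <= max_stretch f z r.
  apply: ub_le_sup; last by exists w.
  by exists 1 => _ [u /= uz <-]; apply/ltW/fd1; rewrite uz.
have low u : distC u z = r -> d2 <= distC (f u) (f z).
  move=> ur; rewrite leNgt; apply/negP => /gd2.
  by rewrite !fK ur ltxx.
have inf_w' : min_stretch f z r <= distC (f w') (f z).
  apply: ge_inf; last by exists w'.
  by exists d2 => _ [u /= uz <-]; exact: low.
have inf0 : 0 < min_stretch f z r.
  apply: lt_le_trans d20 _; apply: lb_le_inf; first by exists (distC (f w) (f z)), w.
  by move=> _ [u /= uz <-]; exact: low.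
rewrite ltr_pdivrMr// => /ltW h; apply: le_trans sup_w _; apply: le_trans h _.
by rewrite ler_wpM2l// addr_ge0.
Qed.

End Homeomorphism.

(** * Radii at which the image of a disc is nearly round *)

Section GoodRadius.
Variable R : realType.
Local Notation C := (Cplx R).
Implicit Types (p v z w : C).

Lemma expr_unbounded (q M : R) : 1 < q -> exists k, M < q ^+ k.
Proof.
move=> q1; have e0 : 0 < q - 1 by rewrite subr_gt0.
have bern k : 1 + (q - 1) * k%:R <= q ^+ k.
  elim: k => [|k IH]; first by rewrite mulr0 addr0 expr0.
  have := ler_wpM2l (ltW (lt_trans ltr01 q1)) IH; rewrite -exprS -natr1.
  by have := mulr_ge0 (sqr_ge0 (q - 1)) (ler0n R k); lra.
have kM := archi_boundP (divr_ge0 (normr_ge0 M) (ltW e0)).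
exists (Num.bound (`|M| / (q - 1))); apply: lt_le_trans (bern _).
by move: kM; rewrite ltr_pdivrMr// mulrC => kM; have := ler_norm M; lra.
Qed.

Variables f g : C -> C.
Hypotheses (cf : continuous f) (cg : continuous g).
Hypotheses (fK : cancel f g) (gK : cancel g f).

(* If o > 4 H^2 l at all small scales, then the oscillation of f on B(z, r)
   decreases by a factor 4 when r is divided by 3, hence it is o(r). *)
Lemma good_radius (H r0 : R) z (rho eta : R) : 1 <= H -> 0 < r0 ->
  (forall r w w', 0 < r < r0 -> distC w z = r -> distC w' z = r ->
    distC (f w) (f z) <= H * distC (f w') (f z)) ->
  0 < rho -> 0 < eta ->
  exists r l o, [/\ 0 < r < rho, 0 <= l <= o, o < rho,
    o <= 4 * H ^+ 2 * l + eta * r &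
    (forall y, distC y (f z) < l -> distC (g y) z < r) /\
    (forall w, distC w z <= 3 * r -> distC (f w) (f z) <= o)].
Proof.
move=> H1 r00 dil rho0 eta0; have H0 : 0 < H by lra.
(* Division by [H] makes the outer radius [H * lam (3 * r)] smaller than [rho]. *)
have /continuous_distCP/(_ z (rho / H))[|d d0 fd] := cf; first by rewrite divr_gt0.
pose rr := Num.min (Num.min r0 rho) d.
have rr0 : 0 < rr by rewrite !lt_min r00 rho0.
have rrP r : r < rr -> [/\ r < r0, r < rho & r < d].
  by rewrite !lt_min => /andP[/andP[]].
(* One point of each circle suffices: up to the factor [H] it controls all others, which gives
   [l = lam r / H] and [o = H * lam (3 * r)]. *)
pose lam r := distC (f (sphere_pt z r)) (f z).
have lam0 r : 0 <= lam r by exact: distC_ge0.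
pose good r := H * lam (3 * r) <= 4 * H ^+ 2 * (lam r / H) + eta * r.
suff [r [rpos r3 gr]] : exists r, [/\ 0 < r, 3 * r < rr & good r].
  have [h1 h2 h3] := rrP _ r3.
  have out w : distC w z <= 3 * r -> distC (f w) (f z) <= H * lam (3 * r).
    move=> /(sphere_dominates_disc cf cg fK gK)[w' w'r] /le_trans; apply.
    by apply: (dil (3 * r)) => //; rewrite ?distC_sphere_pt//; lra.
  exists r, (lam r / H), (H * lam (3 * r)); split => //.
  - by rewrite rpos/=; lra.
  - rewrite divr_ge0 ?(ltW H0)//=; apply: (@le_trans _ _ (lam r)).
      by rewrite ler_pdivrMr// ler_peMr.
    by apply: out; rewrite distC_sphere_pt; lra.
  - have : lam (3 * r) < rho / H by apply: fd; rewrite distC_sphere_pt; lra.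
    by rewrite ltr_pdivlMr// mulrC.
  - split => // y; apply: (image_disc_contains_disc cg fK gK) => // w wr.
    rewrite ler_pdivrMr// mulrC; apply: (dil r) => //; rewrite ?distC_sphere_pt//; lra.
apply: contrapT => /forallNP ngood.
(* Failure at [r] gives both the decay by 4 and a linear lower bound on [lam (3 * r)]; these
   conflict at small scales. *)
have bad r : 0 < r -> 3 * r < rr ->
    4 * lam r <= lam (3 * r) /\ eta * r < H * lam (3 * r).
  move=> rpos r3.
  have : ~ good r by move=> gr; apply: (ngood r).
  move/negP; rewrite -ltNge => h.
  have E : 4 * H ^+ 2 * (lam r / H) = H * (4 * lam r) by field; rewrite gt_eqF.
  rewrite E in h; have := lam0 r; have := lam0 (3 * r) => ? ?.
  have h4 : 0 < eta * r by rewrite mulr_gt0.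
  split; last by nra.
  by rewrite -(ler_pM2l H0); lra.
pose s k := rr / 3 ^+ k.+1.
have s3 k : 3 * s k.+1 = s k by rewrite /s [in LHS]exprS; field; rewrite expf_neq0.
have s0 k : 0 < s k by rewrite divr_gt0// exprn_gt0.
have srr k : s k < rr.
  elim: k => [|k IH]; first by rewrite /s expr1; lra.
  by have := s3 k; have := s0 k; lra.
have dec k : 4 ^+ k * lam (s k) <= lam (s 0).
  elim: k => [|k IH]; first by rewrite expr0 mul1r.
  apply: le_trans IH; rewrite exprSr -mulrA ler_wpM2l ?exprn_ge0//.
  by have := bad _ (s0 k.+1); rewrite s3 => /(_ (srr _))[].
have low k : eta * s k.+1 < H * lam (s k).
  by have := bad _ (s0 k.+1); rewrite s3 => /(_ (srr _))[].
(* Along the scales [s k] the two bounds give [(4 / 3) ^+ k * (eta * rr) < 9 * H * lam (s 0)] for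
   every [k]. *)
have [k kP] := @expr_unbounded (4 / 3) (9 * H * lam (s 0) / (eta * rr)) ltac:(lra).
move: kP; rewrite ltr_pdivrMr ?mulr_gt0// expr_div_n => kP.
have := low k; have := dec k; rewrite /s.
set A : R := 4 ^+ k; set B : R := 3 ^+ k.
have B0 : 0 < B by rewrite exprn_gt0.
have A0 : 0 < A by rewrite exprn_gt0.
rewrite -/(s k) -/(s 0) => h1 h2.
have h3 : A * (eta * (rr / 3 ^+ k.+2)) < H * lam (s 0).
  apply: lt_le_trans (_ : A * (H * lam (s k)) <= _); first by rewrite ltr_pM2l.
  by rewrite mulrCA ler_wpM2l// ltW.
move: h3; rewrite 2!exprS -/B => h3.
have E : A / B * (eta * rr) = 9 * (A * (eta * (rr / (3 * (3 * B))))).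
  by field; rewrite gt_eqF.
rewrite -/A -/B E in kP; lra.
Qed.

End GoodRadius.

(** * The modulus of a ring *)

Section Circle.
Variable R : realType.
Local Notation C := (Cplx R).

(** The intermediate value theorem along an arc of the circle from [u] to [v]. *)
Lemma arc_crossing (f : C -> C) (z0 u v b : C) (x : R) : continuous f ->
  distC u z0 = distC v z0 -> distC (f u) b <= x <= distC (f v) b ->
  exists2 w, distC w z0 = distC u z0 & distC (f w) b = x.
Proof.
move=> cf uv /andP[ux xv].
have [uz|uz] := eqVneq u z0.
  exists u => //; move: uv; rewrite uz distCC => /esym/ComplexField.Normc.eq0_normc.
  move=> /eqP; rewrite subr_eq0 => /eqP vz; apply/eqP; rewrite eq_le.
  by move: ux xv; rewrite uz vz => -> ->.
have u0 : u - z0 != 0 by rewrite subr_eq0.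
have nu0 : 0 < distC u z0 := distC_gt0 uz.
pose e : C := (v - z0) / (u - z0).
have ne : ComplexField.Normc.normc e = 1.
  by rewrite /e ComplexField.Normc.normcM ComplexField.Normc.normcV
    -!/(distC _ _) -uv divff// gt_eqF.
have eE : complex.Re e ^+ 2 + complex.Im e ^+ 2 = 1.
  move: ne; rewrite /e; case: ((v - z0) / (u - z0)) => a c /= h.
  by rewrite -[LHS]sqr_sqrtr ?addr_ge0 ?sqr_ge0// h expr1n.
set a := complex.Re e in eE; set c := complex.Im e in eE.
(* [acos] yields only angles with nonnegative sine; the sign [sg] selects the direction of rotation
   that leads from [u] to [v]. *)
pose sg : R := if 0 <= c then 1 else -1.
have sg2 : sg ^+ 2 = 1 by rewrite /sg; case: ifP; rewrite ?sqrrN expr1n.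
pose gam (th : R) : C := z0 + (Complex (cos th) (sg * sin th) : C) * (u - z0).
have gam_norm th : distC (gam th) z0 = distC u z0.
  rewrite {1}/distC /gam addrC addKr ComplexField.Normc.normcM -/(distC _ _) /=.
  by rewrite exprMn sg2 mul1r cos2Dsin2 sqrtr1 mul1r.
have a1 : -1 <= a <= 1.
  by have := sqr_ge0 c; move: eE; rewrite -ler_norml -(@ler_sqr _ `|a|) ?nnegrE//
    real_normK ?num_real// => *; lra.
have th0 : 0 <= acos a := acos_ge0 a1.
have gam0 : gam 0 = u.
  rewrite /gam cos0 sin0 mulr0 (_ : (1 +i* 0)%C = 1 :> C)// mul1r.
  by rewrite addrC subrK.
have gamth : gam (acos a) = v.
  rewrite /gam acosK// sin_acos//.
  have -> : sg * Num.sqrt (1 - a ^+ 2) = c.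
    rewrite -eE addrAC subrr add0r sqrtr_sqr /sg.
    by case: ifPn => [c0|]; [rewrite mul1r ger0_norm
      |rewrite -ltNge => /ltW c0; rewrite mulN1r ler0_norm// opprK].
  have -> : Complex a c = e by rewrite /a /c; case: (e).
  by rewrite /e divfK// addrC subrK.
have gam_cont th eps : 0 < eps ->
    \forall th' \near th, distC (gam th') (gam th) < eps.
  move=> eps0; pose d := eps / 2 / distC u z0.
  have d0 : 0 < d by rewrite !divr_gt0.
  have /cvgrPdist_lt/(_ d d0) cc := @continuous_cos R th.
  have /cvgrPdist_lt/(_ d d0) ss := @continuous_sin R th.
  apply: filterS2 cc ss => th' /= cc ss.
  rewrite /distC /gam opprD addrACA subrr add0r -mulrBl.
  rewrite ComplexField.Normc.normcM -/(distC u z0) -ltr_pdivlMr//.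
  apply: (le_lt_trans (distC_ReIm (Complex (cos th') (sg * sin th') : C)
    (Complex (cos th) (sg * sin th) : C)).2.2) => /=.
  rewrite -mulrBr normrM (_ : `|sg| = 1); last first.
    by rewrite /sg; case: ifP; rewrite ?normrN normr1.
  rewrite mul1r distrC (distrC (sin _)) [ltRHS](_ : _ = d + d); first lra.
  by rewrite /d; field; rewrite gt_eqF.
have cont : continuous (fun th => distC (f (gam th)) b).
  move=> th; apply/cvgrPdist_lt => eps eps0.
  have /continuous_distCP/(_ (gam th) eps eps0)[d d0 fd] := cf.
  apply: filterS (gam_cont th d d0) => th' /fd.
  apply: le_lt_trans; rewrite ler_norml.
  have := distC_triangle (f (gam th)) (f (gam th')) b.
  have := distC_triangle (f (gam th')) (f (gam th)) b.
  rewrite (distC_sym (f (gam th)) (f (gam th'))).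
  by move=> ? ?; apply/andP; split; lra.
have [||th _ thx] := @IVT R (fun th => distC (f (gam th)) b) 0 (acos a) x th0.
- exact: continuous_subspaceT.
- by rewrite gam0 gamth ge_min le_max ux xv orbT.
- by exists (gam th).
Qed.

Variables f g : C -> C.
Hypotheses (cf : continuous f) (cg : continuous g).
Hypotheses (fK : cancel f g) (gK : cancel g f).

(** The circle meets the preimage of the segment from [line_pt p (b - p) tau] to [b], and that of
    the ray from [p] away from [b]. The images of these points are at distance at most
    [(1 - tau) * distC b p], respectively at least [distC b p], from [b]; an arc joining them
    realizes the values in between. *)
Lemma circle_image_levels (p b z0 : C) (tau t x : R) : 0 < tau < 1 -> b != p ->
  distC (g p) z0 <= t -> distC (g (line_pt p (b - p) tau)) z0 <= t ->
  t <= distC (g b) z0 -> 0 < x < tau * distC b p ->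
  exists2 w, distC w z0 = t & distC (f w) b = distC b p - x.
Proof.
move=> /andP[t0 t1] bp pt qt tb /andP[x0 xt].
have lb : line_pt p (b - p) 1 = b by rewrite /line_pt mul1r addrC subrK.
have lb' : line_pt p (p - b) (-1) = b.
  by rewrite /line_pt rmorphN1 mulN1r opprB addrC subrK.
have lp : line_pt p (p - b) 0 = p by rewrite /line_pt mul0r addr0.
have [|c /andP[tc c1] ct] := @path_crossing _ p (b - p) g z0 tau 1 t cg (ltW t1).
  by rewrite qt lb.
have [||c' c'0 ct'] := @ray_crossing _ f g cf cg gK p (p - b) z0 0 t.
- by rewrite subr_eq0 eq_sym.
- by rewrite lp.
have [||w wt <-] := @arc_crossing f z0 (g (line_pt p (b - p) c))
    (g (line_pt p (p - b) c')) b (distC b p - x) cf; last by exists w => //; rewrite wt.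
- by rewrite ct ct'.
- have E v : distC v 0 = ComplexField.Normc.normc v by rewrite /distC subr0.
  have -> : distC (f (g (line_pt p (b - p) c))) b = `|c - 1| * distC b p.
    by rewrite gK -{2}lb distC_line_pt E.
  have -> : distC (f (g (line_pt p (p - b) c'))) b = `|c' - -1| * distC b p.
    by rewrite gK -{2}lb' distC_line_pt E -/(distC p b) distC_sym.
  have D0 := distC_ge0 b p.
  rewrite distrC ger0_norm ?subr_ge0// opprK ger0_norm ?addr_ge0//.
  by apply/andP; split; nra.
Qed.

End Circle.

(** * The length-area estimate *)

Section Modulus.
Variable R : realType.
Local Notation C := (Cplx R).

(** The Cauchy-Schwarz step, in the form [2 * (l c * r c) <= mu * l c ^+ 2 + r c ^+ 2 / mu]. *)
Lemma weighted_sum_amgm (I : Type) (W : seq I) (o l r : I -> R) (K d s eta : R) :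
  0 < K -> 0 < d -> 0 < s -> 0 < eta -> 48 * (64 * (eta * s)) <= d ->
  (forall c, 0 < r c) -> (forall c, o c <= K * l c + eta * r c) ->
  \sum_(c <- W) r c ^+ 2 <= 64 * s ^+ 2 ->
  d * s <= \sum_(c <- W) 2 * o c * (2 * (3 * r c)) ->
  d ^+ 2 <= 12 * (K * (24 * (64 * K))) * \sum_(c <- W) l c ^+ 2.
Proof.
move=> K0 d0 s0 eta0 etas r0 oP rs ds.
set X := \sum_(c <- W) l c ^+ 2.
set Y := \sum_(c <- W) r c ^+ 2 in rs.
(* With this [mu] the term in [6 * K / mu] is at most [d * s / 4]; small [eta] does the same for the
   term in [12 * eta]. Half of [d * s] is left for the sum of the [l c ^+ 2]. *)
pose mu := 24 * (64 * K) * s / d.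
have mu0 : 0 < mu by rewrite divr_gt0// mulr_gt0//; lra.
have h : d * s <= 6 * K * mu * X + (6 * K / mu + 12 * eta) * Y.
  apply: le_trans ds _; rewrite /X /Y !mulr_sumr -big_split/=.
  apply: ler_sum => c _.
  have h1 : o c * r c <= (K * l c + eta * r c) * r c by rewrite ler_pM2r.
  have h2 : 2 * (l c * r c) <= mu * l c ^+ 2 + r c ^+ 2 / mu.
    rewrite -subr_ge0 (_ : _ - _ = (mu * l c - r c) ^+ 2 / mu).
      by rewrite divr_ge0 ?sqr_ge0// ltW.
    by field; rewrite gt_eqF.
  have := ler_wpM2l (ltW K0) h2.
  rewrite [leRHS](_ : _ = K * mu * l c ^+ 2 + K / mu * r c ^+ 2);
    last by field; rewrite gt_eqF.
  move=> h3; rewrite [leRHS](_ : _ = 6 * (K * mu * l c ^+ 2 + K / mu * r c ^+ 2)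
    + 12 * eta * r c ^+ 2); last by field; rewrite gt_eqF.
  lra.
have hY : (6 * K / mu + 12 * eta) * Y <= d * s / 2.
  apply: (@le_trans _ _ ((6 * K / mu + 12 * eta) * (64 * s ^+ 2))).
    by rewrite ler_wpM2l// addr_ge0// ?divr_ge0 ?mulr_ge0//; lra.
  rewrite mulrDl [6 * K / mu * _](_ : _ = d * s / 4); last first.
    by rewrite /mu; field; rewrite !gt_eqF.
  have := ler_wpM2r (ltW s0) etas; lra.
have : d * s / 2 <= 6 * K * mu * X by lra.
rewrite [leRHS](_ : _ = (6 * (K * (24 * (64 * K))) * X / d) * s); last first.
  by rewrite /mu; field; rewrite gt_eqF.
by rewrite mulrAC ler_pM2r// ler_pdivlMr//; lra.
Qed.

(** Scales grow by the factor 8, and half of the next scale exceeds 3 times the current one. *)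
Lemma dyadic_annulus_unique (s rho : R) (k k' : nat) : 0 < s ->
  s * 8 ^+ k / 2 < rho < 3 * (s * 8 ^+ k) ->
  s * 8 ^+ k' / 2 < rho < 3 * (s * 8 ^+ k') -> k = k'.
Proof.
move=> s0; wlog kk' : k k' / (k <= k')%N => [wl|].
  have [h|/ltnW h] := leqP k k' => h1 h2; first exact: wl.
  by apply/esym/wl.
move: kk'; rewrite leq_eqVlt => /predU1P[//|kk'] /andP[_ h1] /andP[h2 _].
have : s * 8 ^+ k.+1 <= s * 8 ^+ k' by rewrite ler_pM2l// ler_eXn2l//; lra.
have : 0 < s * 8 ^+ k by rewrite mulr_gt0// exprn_gt0.
by rewrite exprS => ? ?; exfalso; lra.
Qed.

Variables f g : C -> C.
Hypotheses (cf : continuous f) (cg : continuous g).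
Hypotheses (fK : cancel f g) (gK : cancel g f).
Variable H : R.
Hypothesis H1 : 1 <= H.
Hypothesis dil : forall z, exists2 r0, 0 < r0 & forall r w w', 0 < r < r0 ->
  distC w z = r -> distC w' z = r -> distC (f w) (f z) <= H * distC (f w') (f z).

(** The factor 36 comes from image discs within [3 * distC b p] of [b], the other one from
    [weighted_sum_amgm] with the constant [4 * H ^+ 2] of [good_radius]. *)
Lemma ring_modulus_bound (N : nat) (p b z0 : C) (tau s : R) :
  0 < tau < 1 -> 0 < s -> distC (g p) z0 <= s ->
  distC (g (line_pt p (b - p) tau)) z0 <= s -> s * 8 ^+ N <= distC (g b) z0 ->
  N%:R * tau ^+ 2 <=
    36 * (12 * (4 * H ^+ 2 * (24 * (64 * (4 * H ^+ 2))))).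
Proof.
move=> tau01 s0 ps qs sb; have [t0 t1] := andP tau01.
(* For [N = 0] the points [p] and [b] might coincide. *)
case: N => [|N0] in sb *; first by rewrite mul0r; have := sqr_ge0 (H ^+ 2); lra.
move: sb; set N := N0.+1 => sb.
have H0 : 0 < H := lt_le_trans ltr01 H1.
set K := 4 * H ^+ 2; have K0 : 0 < K by rewrite /K mulr_gt0 ?exprn_gt0.
have S1 k : 1 <= 8 ^+ k :> R by rewrite exprn_ege1//; lra.
have sN : s < s * 8 ^+ N.
  have h := S1 N0; rewrite -[X in X < _]mulr1 ltr_pM2l// /N exprS.
  by move: h; set x := 8 ^+ N0; lra.
have bp : b != p.
  by apply: contraPneq sN => bp; apply/negP; rewrite -leNgt (le_trans sb)// bp.
set D := distC b p; have D0 : 0 < D := distC_gt0 bp.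
pose rho := Num.min (s / 16) D.
have rho0 : 0 < rho by rewrite lt_min D0 divr_gt0.
(* The largest scale in the denominator makes one [eta] small enough for all annuli. *)
pose eta := tau * D / (48 * (64 * (s * 8 ^+ N))).
have eta0 : 0 < eta by rewrite divr_gt0 ?mulr_gt0// ?exprn_gt0.
have rlo : forall c, exists r l o,
    [/\ 0 < r < rho, 0 <= l <= o, o < rho, o <= K * l + eta * r &
    (forall y, distC y (f c) < l -> distC (g y) c < r) /\
    (forall w, distC w c <= 3 * r -> distC (f w) (f c) <= o)].
  by move=> c; have [r0 r00 rP] := dil c; apply: (good_radius cf cg fK gK H1 r00 rP).
have {rlo} [r rlo] := choice rlo.
have {rlo} [l rlo] := choice rlo.
have {rlo} [ o rlo ] := choice rlo.
have r0 c : 0 < r c by have [/andP[]] := rlo c.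
have rs c : r c < s / 16 by have [/andP[_]] := rlo c; rewrite lt_min => /andP[].
have l0 c : 0 <= l c by have [_ /andP[]] := rlo c.
have lo c : l c <= o c by have [_ /andP[]] := rlo c.
have oD c : o c < D by have [_ _] := rlo c; rewrite lt_min => /andP[].
have o0 c : 0 <= o c := le_trans (l0 c) (lo c).
have oKl c : o c <= K * l c + eta * r c by have [] := rlo c.
have inner c y : distC y (f c) < l c -> distC (g y) c < r c.
  by have [_ _ _ _ [h _]] := rlo c; exact: h.
have outer c w : distC w c <= 3 * r c -> distC (f w) (f c) <= o c.
  by have [_ _ _ _ [_ h]] := rlo c; exact: h.
have [L LP] := disc_finite_cover z0 (s * 8 ^+ N) r0.
have [V [uV _ Vdisj LV]] := vitali_disc_cover r L.
(* Other discs never contribute, since the points [w] used have [distC (f w) b < D] and [o c < D].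
   The inner image discs of those kept stay within [3 * D] of [b]. *)
pose W := [seq c <- V | distC (f c) b < 2 * D].
have uW : uniq W by rewrite filter_uniq.
have WV c : c \in W -> c \in V by rewrite mem_filter => /andP[].
(* The intervals of radius [o c] about [D - distC (f c) b] cover []0, tau * D[]. *)
have levels t : s <= t <= s * 8 ^+ N ->
    tau * D <= \sum_(c <- W | `|t - distC c z0| <= 3 * r c) 2 * o c.
  move=> /andP[st tN].
  rewrite -big_filter; set W' := [seq _ <- W | _].
  rewrite -[leLHS]mul1r -[tau * D]subr0.
  under [leRHS]eq_bigr do rewrite -[2 * o _]mul1r.
  apply: (@weighted_interval_cover _ _ W' (fun c => D - distC (f c) b) o (fun=> 1)) => //.
    by rewrite mulr_ge0// ltW.
  move=> x xd.
  have [w wt fwb] := circle_image_levels cf cg gK tau01 bp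
    (le_trans ps st) (le_trans qs st) (le_trans tN sb) xd.
  have [|c cL wc] := LP w; first by rewrite wt.
  have [c' c'V wc'] := LV _ _ cL wc.
  have := outer c' w (ltW wc') => fwc'.
  have := distC_triangle c' w z0; have := distC_triangle w c' z0.
  have := distC_triangle (f c') (f w) b; have := distC_triangle (f w) (f c') b.
  rewrite (distC_sym c' w) (distC_sym (f c') (f w)) wt fwb -/D => h1 h2 h3 h4.
  have xD : 0 < x by case/andP: xd.
  have oDc' := oD c'.
  have c'W' : c' \in W'.
    rewrite !mem_filter c'V andbT; apply/andP; split; last lra.
    by rewrite ler_norml; apply/andP; split; lra.
  rewrite (big_rem c')//= (_ : `|_| <= _) ?lerDl ?sumr_ge0//.
  by rewrite ler_norml; apply/andP; split; lra.
(* A tripled disc that meets a circle of radius between [s * 8 ^+ k] and twice that has its centre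
   here, because [r c < s / 16]. *)
pose Pk k c := s * 8 ^+ k / 2 < distC c z0 < 3 * (s * 8 ^+ k).
have annulus k : (k < N)%N ->
    (tau * D) ^+ 2 <= 12 * (K * (24 * (64 * K))) * \sum_(c <- W | Pk k c) l c ^+ 2.
  move=> kN; set sk := s * 8 ^+ k.
  have sk0 : 0 < sk by rewrite mulr_gt0// exprn_gt0.
  have ssk : s <= sk by rewrite -[leLHS]mulr1 ler_pM2l.
  have skN : 8 * sk <= s * 8 ^+ N.
    by rewrite mulrCA -exprS ler_pM2l// ler_eXn2l//; lra.
  rewrite -big_filter; set Wk := [seq c <- W | _].
  have WkW c : c \in Wk -> c \in W by rewrite mem_filter => /andP[].
  apply: (@weighted_sum_amgm _ Wk o l r K _ sk eta) => //.
  - by rewrite mulr_gt0.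
  - have S0 : 0 < s * 8 ^+ N by lra.
    have -> : 48 * (64 * (eta * sk)) = tau * D * (sk / (s * 8 ^+ N)).
      by move: S0; rewrite /eta; move: (s * _) => S S0; field; rewrite gt_eqF.
    rewrite ler_piMr ?(ltW (mulr_gt0 t0 D0))// ler_pdivrMr//; lra.
  - have -> : 64 * sk ^+ 2 = 4 * (4 * sk) ^+ 2 by ring.
    apply: (@disjoint_discs_area _ C Wk id r z0).
    + by rewrite filter_uniq.
    + by lra.
    + by move=> c _; exact: ltW.
    + by move=> c c' x /WkW/WV cV /WkW/WV c'V; exact: Vdisj.
    + move=> c x; rewrite mem_filter /Pk -/sk => /andP[/andP[_ h] _] /= xc.
      by have := distC_triangle c x z0; have := rs c; lra.
  - rewrite [X in X <= _](_ : _ = tau * D * (2 * sk - sk)); last by ring.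
    apply: (@weighted_interval_cover _ _ Wk (fun c => distC c z0)
        (fun c => 3 * r c) (fun c => 2 * o c)).
    + lra.
    + by rewrite mulr_ge0// ltW.
    + by move=> c; rewrite mulr_ge0// ltW.
    + by move=> c; rewrite mulr_ge0.
    + move=> x /andP[x1 x2].
      apply: le_trans (levels x _) _; first by apply/andP; split; lra.
      rewrite /Wk [leRHS]big_filter_cond/=.
      rewrite big_mkcond [leRHS]big_mkcond/=; apply: ler_sum => c _.
      case: ifP => h; last by case: ifP; rewrite // mulr_ge0.
      rewrite andbT ifT//.
      move: h; rewrite -/sk ler_norml => /andP[? ?].
      by have := rs c; have := r0 c; move=> ? ?; apply/andP; split; lra.
(* Each disc counts for at most one [k], and the inner image discs are disjoint because [g] maps
   them into the disjoint discs of [V]. *)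
have tot : \sum_(k < N) \sum_(c <- W | Pk k c) l c ^+ 2 <= 36 * D ^+ 2.
  apply: (@le_trans _ _ (\sum_(c <- W) l c ^+ 2)).
    under eq_bigr do rewrite big_mkcond/=.
    rewrite exchange_big/=; apply: ler_sum => c _.
    have [[k Pkc]|noP] := pselect (exists k : 'I_N, Pk k c).
      rewrite (bigD1 k)//= Pkc big1 ?addr0// => k' k'k; case: ifPn => // Pk'c.
      move: k'k; rewrite -val_eqE/= => /eqP[]; exact: dyadic_annulus_unique Pk'c Pkc.
    rewrite big1 ?sqr_ge0// => k _; case: ifPn => // Pkc.
    by exfalso; apply: noP; exists k.
  have -> : 36 * D ^+ 2 = 4 * (3 * D) ^+ 2 by ring.
  apply: (@disjoint_discs_area _ C W f l b) => //.
  - by lra.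
  - by move=> c c' x /WV cV /WV c'V /inner xc /inner xc'; exact: Vdisj xc xc'.
  - move=> c x; rewrite mem_filter => /andP[h _] xc.
    by have := distC_triangle (f c) x b; have := lo c; have := oD c; lra.
have : \sum_(k < N) (tau * D) ^+ 2 <=
    12 * (K * (24 * (64 * K))) * \sum_(k < N) \sum_(c <- W | Pk k c) l c ^+ 2.
  by rewrite mulr_sumr; apply: ler_sum => k _; exact: annulus.
rewrite sumr_const card_ord => h.
have h2 : N%:R * (tau * D) ^+ 2 <= 12 * (K * (24 * (64 * K))) * (36 * D ^+ 2).
  by rewrite mulr_natl; apply: le_trans h _; rewrite ler_wpM2l//; have := sqr_ge0 K; lra.
have D20 : 0 < D ^+ 2 by rewrite exprn_gt0.
rewrite -(ler_pM2r D20); move: h2; rewrite exprMn; lra.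
Qed.

End Modulus.

(** * Generalized Cantor sets *)

Section CantorSet.
Variable R : realType.
Variable w : nat -> R.
Hypothesis w01 : seq01 w.
Implicit Types (J P : R * R) (k n : nat) (x y : R).

Definition left_child (q : R) J : R * R :=
  (J.1, (J.1 + J.2) / 2 - q * (J.2 - J.1) / 2).
Definition right_child (q : R) J : R * R :=
  ((J.1 + J.2) / 2 + q * (J.2 - J.1) / 2, J.2).

Let w0 n : 0 < w n. Proof. by have /andP[] := w01 n. Qed.
Let w1 n : w n < 1. Proof. by have /andP[] := w01 n. Qed.

Lemma cantor_itvsSP k J : reflect
  (exists2 P, P \in cantor_itvs w k & J = left_child (w k) P \/ J = right_child (w k) P)
  (J \in cantor_itvs w k.+1).
Proof.
apply: (iffP flattenP) => [[s /mapP[P Pk ->]]|[P Pk H]].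
  by rewrite !inE => /orP[] /eqP ->; exists P; rewrite //; [left|right].
exists (split_itv (w k) P); first exact: map_f.
by rewrite !inE; case: H => ->; rewrite eqxx ?orbT.
Qed.

Lemma left_child_itv k J : J \in cantor_itvs w k ->
  left_child (w k) J \in cantor_itvs w k.+1.
Proof. by move=> Jk; apply/cantor_itvsSP; exists J => //; left. Qed.

Lemma right_child_itv k J : J \in cantor_itvs w k ->
  right_child (w k) J \in cantor_itvs w k.+1.
Proof. by move=> Jk; apply/cantor_itvsSP; exists J => //; right. Qed.

Lemma cantor_itvs_lt k J : J \in cantor_itvs w k ->
  [/\ 0 <= J.1, J.1 < J.2 & J.2 <= 1].
Proof.
elim: k J => [|k IH] J; first by rewrite inE => /eqP ->; rewrite /= lexx ltr01.
move=> /cantor_itvsSP[P /IH[h1 h2 h3] H]; have := w0 k; have := w1 k.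
have hp : 0 < P.2 - P.1 by rewrite subr_gt0.
move=> q1 q0; have h4 : 0 < (1 - w k) * (P.2 - P.1) by rewrite mulr_gt0// subr_gt0.
have h5 : 0 < w k * (P.2 - P.1) by rewrite mulr_gt0.
by case: H => -> /=; split; lra.
Qed.

Lemma cantor_itvs_length k J : J \in cantor_itvs w k -> J.2 - J.1 <= 2^-1 ^+ k.
Proof.
elim: k J => [|k IH] J; first by rewrite inE => /eqP ->; rewrite /= subr0.
move=> /cantor_itvsSP[P Pk H]; have [_ P12 _] := cantor_itvs_lt Pk.
have h5 : 0 < w k * (P.2 - P.1) by rewrite mulr_gt0// subr_gt0.
have := IH _ Pk; rewrite exprS.
by case: H => -> /=; lra.
Qed.

Lemma cantor_itvs_disjoint k J J' x : J \in cantor_itvs w k ->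
  J' \in cantor_itvs w k -> J.1 <= x <= J.2 -> J'.1 <= x <= J'.2 -> J = J'.
Proof.
elim: k J J' => [|k IH] J J'; first by rewrite !inE => /eqP -> /eqP ->.
move=> /cantor_itvsSP[P Pk H] /cantor_itvsSP[P' P'k H'] /andP[x1 x2] /andP[x3 x4].
have [_ P12 _] := cantor_itvs_lt Pk.
have [_ P12' _] := cantor_itvs_lt P'k.
have h5 : 0 < w k * (P.2 - P.1) by rewrite mulr_gt0// subr_gt0.
have h5' : 0 < w k * (P'.2 - P'.1) by rewrite mulr_gt0// subr_gt0.
have h6 : 0 < (1 - w k) * (P.2 - P.1) by rewrite mulr_gt0// subr_gt0.
have h6' : 0 < (1 - w k) * (P'.2 - P'.1) by rewrite mulr_gt0// subr_gt0.
have PP' : P = P'.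
  apply: IH => //; apply/andP; split.
  - by case: H x1 => -> /=; lra.
  - by case: H x2 => -> /=; lra.
  - by case: H' x3 => -> /=; lra.
  - by case: H' x4 => -> /=; lra.
subst P'; case: H x1 x2 => ->; case: H' x3 x4 => -> //= ? ? ? ?; exfalso; lra.
Qed.

Lemma cantor_levelS k x : cantor_level w k.+1 x -> cantor_level w k x.
Proof.
move=> [J /cantor_itvsSP[P Pk H] /andP[x1 x2]]; exists P => //.
have [_ P12 _] := cantor_itvs_lt Pk.
have h5 : 0 < w k * (P.2 - P.1) by rewrite mulr_gt0// subr_gt0.
have h6 : 0 < (1 - w k) * (P.2 - P.1) by rewrite mulr_gt0// subr_gt0.
by apply/andP; split; [case: H x1|case: H x2] => -> /=; lra.
Qed.

Lemma cantor_set_child k J x : J \in cantor_itvs w k -> cantor_set w x ->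
  J.1 <= x <= J.2 ->
  x <= (left_child (w k) J).2 \/ (right_child (w k) J).1 <= x.
Proof.
move=> Jk /(_ k.+1 isT)[J' /cantor_itvsSP[P Pk H] xJ'] xJ.
have [_ P12 _] := cantor_itvs_lt Pk.
have h5 : 0 < w k * (P.2 - P.1) by rewrite mulr_gt0// subr_gt0.
have h6 : 0 < (1 - w k) * (P.2 - P.1) by rewrite mulr_gt0// subr_gt0.
have PJ : P = J.
  apply: cantor_itvs_disjoint Pk Jk _ xJ; move: xJ' => /andP[x1 x2].
  by apply/andP; split; [case: H x1|case: H x2] => -> /=; lra.
by subst P; move: xJ' => /andP[x1 x2]; case: H x1 x2 => -> /=; [left|right].
Qed.

(** An endpoint remains an endpoint of some descendant at every later level. *)
Lemma cantor_set_endpoints k J : J \in cantor_itvs w k ->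
  cantor_set w J.1 /\ cantor_set w J.2.
Proof.
move=> Jk.
have down n m x : cantor_level w (m + n)%N x -> cantor_level w n x.
  by elim: m => // m IH; rewrite addSn => /cantor_levelS.
have left_pt n J' : J' \in cantor_itvs w n ->
    forall m, exists2 J'', J'' \in cantor_itvs w (m + n) & J''.1 = J'.1.
  move=> J'n; elim => [|m [J'' h1 h2]]; first by exists J'.
  by exists (left_child (w (m + n)) J''); [exact: left_child_itv|].
have right_pt n J' : J' \in cantor_itvs w n ->
    forall m, exists2 J'', J'' \in cantor_itvs w (m + n) & J''.2 = J'.2.
  move=> J'n; elim => [|m [J'' h1 h2]]; first by exists J'.
  by exists (right_child (w (m + n)) J''); [exact: right_child_itv|].
split=> m _; apply: (down m k); rewrite addnC.
  have [J' h1 h2] := left_pt _ _ Jk m; exists J' => //.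
  by have [_ /ltW h _] := cantor_itvs_lt h1; rewrite -h2 lexx.
have [J' h1 h2] := right_pt _ _ Jk m; exists J' => //.
by have [_ /ltW h _] := cantor_itvs_lt h1; rewrite -h2 lexx andbT.
Qed.

(** [l] is the length of the leftmost interval of level [n], whose children have length
    [(1 - w n) * l / 2]; points of the set beyond it fall under the second alternative. *)
Lemma cantor_set_leftmost_gap n : exists l, [/\ 0 < l, l <= 1 &
  forall x, cantor_set w x -> 0 <= x /\
    (x <= (1 - w n) * l / 2 \/ l - (1 - w n) * l / 2 <= x)].
Proof.
have [J Jn J0] : exists2 J, J \in cantor_itvs w n & J.1 = 0.
  elim: n => [|n [J Jn J0]]; first by exists (0, 1); rewrite ?inE.
  by exists (left_child (w n) J); [exact: left_child_itv|].
have [_ J12 J21] := cantor_itvs_lt Jn; rewrite J0 in J12.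
exists J.2; split => // x xE.
have x0 : 0 <= x.
  have [P P1 /andP[Px _]] := xE 1%N isT.
  by have [P0 _ _] := cantor_itvs_lt P1; apply: le_trans Px.
split=> //; have [xJ|Jx] := leP x J.2; last first.
  have : 0 < (1 - w n) * J.2 by rewrite mulr_gt0// subr_gt0.
  by right; lra.
have [] := cantor_set_child Jn xE; rewrite /= ?J0.
- by rewrite x0.
- by left; lra.
- by right; lra.
Qed.

(* A smallest interval containing points of both classes has children each of
   which meets only one class; it exists since lengths tend to 0. *)
Lemma cantor_set_separation (cls : set R) :
  (exists2 x, cantor_set w x & cls x) ->
  (exists2 x, cantor_set w x & ~ cls x) ->
  (forall x, exists2 d, 0 < d & forall y y', cantor_set w y ->
    cantor_set w y' -> `|y - x| < d -> `|y' - x| < d -> cls y -> cls y') ->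
  exists k J, J \in cantor_itvs w k /\
    ([/\ cls J.1, cls (left_child (w k) J).2 & ~ cls (right_child (w k) J).1] \/
     [/\ cls J.2, cls (right_child (w k) J).1 & ~ cls (left_child (w k) J).2]).
Proof.
move=> [x0 x0E x0c] [y0 y0E y0c] loc.
pose mixed J := exists x y, [/\ cantor_set w x, cantor_set w y, cls x, ~ cls y &
  J.1 <= x <= J.2 /\ J.1 <= y <= J.2].
have unit_itv x : cantor_set w x -> 0 <= x <= 1.
  move=> /(_ 1%N isT)[J J1 /andP[h1 h2]]; have [h3 _ h4] := cantor_itvs_lt J1.
  by rewrite (le_trans h3)//= (le_trans h2).
have [k [J [Jk mJ nl nr]]] : exists k J, [/\ J \in cantor_itvs w k, mixed J,
    ~ mixed (left_child (w k) J) & ~ mixed (right_child (w k) J)].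
  apply: contrapT => no.
  have child k J : J \in cantor_itvs w k -> mixed J ->
      ~ mixed (left_child (w k) J) -> mixed (right_child (w k) J).
    by move=> Jk mJ nl; apply: contrapT => nr; apply: no; exists k, J.
  (* If every mixed interval had a mixed child, this choice would give a nested sequence of mixed
     intervals. *)
  pose node := fix node k : R * R := if k is k'.+1 then
    if `[< mixed (left_child (w k') (node k')) >]
    then left_child (w k') (node k') else right_child (w k') (node k') else (0, 1).
  have nodeP k : node k \in cantor_itvs w k /\ mixed (node k).
    elim: k => [|k [IH1 IH2]] /=.
      by split; [rewrite inE|exists x0, y0; split => //; split; exact: unit_itv].
    case: asboolP => h; split => //; [exact: left_child_itv|exact: right_child_itv|].
    exact: child.
  have node_lt k : (node k).1 < (node k).2.
    by have [] := cantor_itvs_lt (nodeP k).1.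
  have nested k : (node k).1 <= (node k.+1).1 /\ (node k.+1).2 <= (node k).2.
    have hh := node_lt k.
    have h5 : 0 < w k * ((node k).2 - (node k).1) by rewrite mulr_gt0// subr_gt0.
    have h6 : 0 < (1 - w k) * ((node k).2 - (node k).1) by rewrite mulr_gt0// subr_gt0.
    by rewrite /=; case: ifP => _ /=; split; lra.
  have lows m k : (node m).1 <= (node (k + m)%N).1 /\ (node (k + m)%N).2 <= (node m).2.
    elim: k => [|k [IH1 IH2]]; first by rewrite add0n.
    have [h1 h2] := nested (k + m)%N; rewrite addSn.
    by split; [exact: le_trans h1|exact: le_trans IH2].
  have cross m k : (node m).1 <= (node k).2.
    have := lows m k; have := lows k m; rewrite addnC => -[_ h1] [h2 _].
    by apply: le_trans h2 _; apply: le_trans (ltW (node_lt _)) h1.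
  (* The common point of the nested intervals: [cls] is constant near it on the Cantor set, yet
     arbitrarily short intervals around it are mixed. *)
  pose x := sup (range (fun k => (node k).1)).
  have hs : has_sup (range (fun k => (node k).1)).
    by split; [exists (node 0).1, 0%N|exists (node 0).2 => _ [k _ <-]; exact: cross].
  have xk k : (node k).1 <= x <= (node k).2.
    apply/andP; split; first by apply: ub_le_sup; [case: hs|exists k].
    by apply: ge_sup; [case: hs|move=> _ [m _ <-]; exact: cross].
  have [d d0 dP] := loc x.
  have [k kd] := @expr_unbounded R 2 d^-1 ltac:(lra).
  have [_ [y [y' [yE y'E yc y'c [yk y'k]]]]] := nodeP k.
  apply: y'c; apply: dP yE y'E _ _ yc.
  - have := cantor_itvs_length (nodeP k).1; move: yk (xk k) => /andP[? ?] /andP[? ?].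
    move: kd; rewrite invf_plt ?posrE ?exprn_gt0// -exprVn => ? ?.
    by rewrite ltr_norml; apply/andP; split; lra.
  - have := cantor_itvs_length (nodeP k).1; move: y'k (xk k) => /andP[? ?] /andP[? ?].
    move: kd; rewrite invf_plt ?posrE ?exprn_gt0// -exprVn => ? ?.
    by rewrite ltr_norml; apply/andP; split; lra.
exists k, J; split=> //; move: mJ => [x [y [xE yE xc yc [xJ yJ]]]].
have [lE1 lE2] := cantor_set_endpoints (left_child_itv Jk).
have [rE1 rE2] := cantor_set_endpoints (right_child_itv Jk).
have [_ l12 _] := cantor_itvs_lt (left_child_itv Jk).
have [_ r12 _] := cantor_itvs_lt (right_child_itv Jk).
(* The child containing [x] is not mixed, so its points of the set are in [cls]; hence [y] is in the
   other child, whose points of the set are not. *)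
have [xl|xr] := cantor_set_child Jk xE xJ; last first.
  have xR : (right_child (w k) J).1 <= x <= (right_child (w k) J).2.
    by rewrite xr /=; case/andP: xJ.
  have allR z : cantor_set w z ->
      (right_child (w k) J).1 <= z <= (right_child (w k) J).2 -> cls z.
    by move=> zE zR; apply: contrapT => zc; apply: nr; exists x, z.
  right; split; [by apply: allR => //; rewrite lexx (ltW r12)
    |by apply: allR => //; rewrite lexx (ltW r12)|move=> lc].
  have [yl|yr] := cantor_set_child Jk yE yJ.
    apply: nl; exists (left_child (w k) J).2, y; split => //.
    by rewrite lexx (ltW l12) yl /= andbT; case/andP: yJ.
  by apply: yc; apply: allR => //; rewrite yr; case/andP: yJ.
have xL : (left_child (w k) J).1 <= x <= (left_child (w k) J).2.
  by rewrite xl andbT; case/andP: xJ.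
have allL z : cantor_set w z ->
    (left_child (w k) J).1 <= z <= (left_child (w k) J).2 -> cls z.
  by move=> zE zR; apply: contrapT => zc; apply: nl; exists x, z.
left; split; [by apply: allL => //; rewrite lexx (ltW l12)
  |by apply: allL => //; rewrite lexx (ltW l12)|move=> rc].
have [yl|yr] := cantor_set_child Jk yE yJ.
  by apply: yc; apply: allL => //; rewrite yl andbT; case/andP: yJ.
apply: nr; exists (right_child (w k) J).1, y; split => //.
by rewrite lexx (ltW r12) yr; case/andP: yJ.
Qed.

End CantorSet.

(** * The moduli space *)

Section Final.
Variable R : realType.
Local Notation C := (Cplx R).
Implicit Types w : nat -> R.

Lemma distC_real (x y : R) : distC ((x%:C)%C : C) ((y%:C)%C : C) = `|x - y|.
Proof. by rewrite /distC -rmorphB /= expr0n addr0 sqrtr_sqr. Qed.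

Lemma line_pt_real (x y t : R) :
  line_pt ((x%:C)%C : C) ((y%:C)%C - (x%:C)%C : C) t = ((x + t * (y - x))%:C)%C.
Proof. by rewrite /line_pt -rmorphB -rmorphM -rmorphD. Qed.

Lemma moduli_space_bounded_away w w' : Omega_b w -> moduli_space w w' ->
  exists2 c, c < 1 & forall n, w' n <= c.
Proof.
move=> [w01 supw] [w'01 [f [[[cf [g [cg fK gK]]] [H dH]] fE]]].
set q := sup (range w) in supw.
have wq n : w n <= q.
  apply: ub_le_sup; last by exists n.
  by exists 1 => _ [m _ <-]; have /andP[_ /ltW] := w01 m.
have q0 : 0 < q by have /andP[h _] := w01 0%N; exact: lt_le_trans h (wq 0%N).
have HH1 : 1 <= `|H| + 1 by rewrite lerDr.
have dil z := dilatation_bound cf cg fK (dH z).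
(* A child takes the share [(1 - w k) / (1 + w k)] of child plus gap, which is at least [tau0] since
   [w k <= q]. *)
pose tau0 := (1 - q) / (1 + q).
have tau00 : 0 < tau0 by rewrite divr_gt0//; lra.
have [M MP] : exists M, forall N (p b z0 : C) (tau s : R), 0 < tau < 1 -> 0 < s ->
    distC (g p) z0 <= s -> distC (g (line_pt p (b - p) tau)) z0 <= s ->
    s * 8 ^+ N <= distC (g b) z0 -> N%:R * tau ^+ 2 <= M.
  by eexists => N p b z0 tau s; exact: (ring_modulus_bound cf cg fK gK HH1 dil).
have [N NP] : exists N, M < N%:R * tau0 ^+ 2.
  have t2 : 0 < tau0 ^+ 2 by rewrite exprn_gt0.
  exists (Num.bound (`|M| / tau0 ^+ 2)); rewrite -ltr_pdivrMr//.
  apply: le_lt_trans (archi_boundP _); last by rewrite divr_ge0// ltW.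
  by rewrite ler_pM2r ?invr_gt0// ler_norm.
have S0 : 0 < 8 ^+ N :> R by rewrite exprn_gt0.
apply: contrapT => nc.
(* The threshold ensures [e * 8 ^+ N <= l - e] for the child length [e] below, so a ring of ratio
   [8 ^+ N] fits between the two parts. *)
have [n wn] : exists n, 1 - (8 ^+ N + 1)^-1 < w' n.
  apply: contrapT => /forallNP h; apply: nc; exists (1 - (8 ^+ N + 1)^-1).
    by rewrite ltrBlDr ltrDl invr_gt0 addr_gt0.
  by move=> n; rewrite leNgt; apply/negP; exact: h.
have [l [l0 l1 lE]] := cantor_set_leftmost_gap w'01 n.
have /andP[w'n0 w'n1] := w'01 n.
set e := (1 - w' n) * l / 2 in lE.
have e0 : 0 < e by rewrite divr_gt0// mulr_gt0// subr_gt0.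
have eN : e * (8 ^+ N + 1) < l / 2.
  have h : (1 - w' n) * (8 ^+ N + 1) < 1.
    by rewrite -ltr_pdivlMr ?addr_gt0// mul1r; lra.
  rewrite [ltLHS](_ : _ = (1 - w' n) * (8 ^+ N + 1) * (l / 2)); last by rewrite /e; ring.
  by rewrite gtr_pMl ?divr_gt0.
have e8 : 0 < e * 8 ^+ N by rewrite mulr_gt0.
have endpts : cantor_set w' 0 /\ cantor_set w' 1.
  by apply: (@cantor_set_endpoints _ w' w'01 0 (0, 1)); rewrite inE.
(* Points coming from the left part, in [[0, e]]; preimages of the other points of the set have norm
   at least [l - e]. *)
pose cls := [set y : R | distC (g ((y%:C)%C : C)) 0 <= e].
have gE y : cantor_set w y -> exists2 x, cantor_set w' x & g (y%:C)%C = (x%:C)%C.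
  move=> yE; have : real_in_C (cantor_set w) ((y%:C)%C : C) by exists y.
  by rewrite -fE => -[_ [x xE <-] <-]; exists x; rewrite ?fK.
have fE' x : cantor_set w' x -> exists2 y, cantor_set w y & g (y%:C)%C = (x%:C)%C.
  move=> xE; have : real_in_C (cantor_set w) (f (x%:C)%C : C).
    by rewrite -fE; exists ((x%:C)%C) => //; exists x.
  by move=> [y yE yx]; exists y; rewrite // yx fK.
have gnorm y : cantor_set w y -> exists2 x, distC (g (y%:C)%C) 0 = x &
    (x <= e \/ l - e <= x) /\ g (y%:C)%C = (x%:C)%C.
  move=> /gE[x /lE[x0 xle] gx]; exists x => //.
  by rewrite gx -(rmorph0 (real_complex R)) distC_real subr0 ger0_norm.
have ncls y : cantor_set w y -> ~ cls y -> l - e <= distC (g (y%:C)%C) 0.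
  by move=> /gnorm[x xE [[h|h] _]] yc; rewrite xE // ?h //; case: yc; rewrite /cls/= xE.
have [||x|k [J [Jk HJ]]] := @cantor_set_separation _ w w01 cls.
- have [y yE y0] := fE' 0 endpts.1; exists y => //.
  by rewrite /cls/= y0 -(rmorph0 (real_complex R)) distC_real subrr normr0 ltW.
- have [y yE y1] := fE' 1 endpts.2; exists y => //.
  rewrite /cls/= y1 -(rmorph0 (real_complex R)) distC_real subr0 normr1.
  by apply/negP; rewrite -ltNge; lra.
(* The two parts are at least [l - 2 * e] apart, so preimages within half of that from [g x] belong
   to the same part. *)
- have /continuous_distCP/(_ (x%:C)%C ((l - 2 * e) / 2))[|d d0 gd] := cg; first by lra.
  exists d => // y y' yE y'E yx y'x yc; apply: contrapT => y'c.
  have h1 := ncls _ y'E y'c; have h2 : distC (g (y%:C)%C) 0 <= e := yc.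
  have := gd (y%:C)%C; rewrite distC_real => /(_ yx) h3.
  have := gd (y'%:C)%C; rewrite distC_real => /(_ y'x) h4.
  have := distC_triangle (g (y%:C)%C) (g (y'%:C)%C) 0.
  have := distC_triangle (g (x%:C)%C) (g (y'%:C)%C) (g (y%:C)%C).
  by rewrite (distC_sym (g (x%:C)%C) (g (y%:C)%C)); lra.
have /andP[wk0 wk1] := w01 k.
have [_ J12 _] := cantor_itvs_lt w01 Jk.
pose tau := (1 - w k) / (1 + w k).
have tau01 : 0 < tau < 1.
  by rewrite divr_gt0 ?subr_gt0 ?addr_gt0//= ltr_pdivrMr ?addr_gt0//; lra.
have tau_ge : tau0 <= tau.
  rewrite /tau0 /tau ler_pdivrMr ?addr_gt0// mulrAC ler_pdivlMr ?addr_gt0//.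
  by have := wq k; nra.
have [l1E l2E] := cantor_set_endpoints w01 (left_child_itv Jk).
have [r1E r2E] := cantor_set_endpoints w01 (right_child_itv Jk).
have low : e * 8 ^+ N <= l - e by lra.
have : N%:R * tau ^+ 2 <= M.
  (* [p] is the outer endpoint of the child in [cls] and [b] the facing endpoint of the other child;
     the parameter [tau] gives the inner endpoint of the first. *)
  case: HJ => -[c1 c2 c3].
  - apply: (MP N (J.1%:C)%C ((right_child (w k) J).1%:C)%C 0 tau e) => //.
    + rewrite line_pt_real (_ : _ + _ = (left_child (w k) J).2)//.
      by rewrite /tau /=; field; rewrite gt_eqF// addr_gt0.
    + exact: le_trans low (ncls _ r1E c3).
  - apply: (MP N (J.2%:C)%C ((left_child (w k) J).2%:C)%C 0 tau e) => //.
    + rewrite line_pt_real (_ : _ + _ = (right_child (w k) J).1)//.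
      by rewrite /tau /=; field; rewrite gt_eqF// addr_gt0.
    + exact: le_trans low (ncls _ l2E c3).
apply/negP; rewrite -ltNge; apply: lt_le_trans NP _.
by rewrite ler_wpM2l// ler_sqr ?nnegrE// ltW//; case/andP: tau01.
Qed.

Lemma bounded_coordinates_measurable (n : nat) (c : R) :
  measurable [set w : seqR R | forall i, (i < n)%N -> w i <= c].
Proof.
rewrite (_ : mkset _ = \bigcap_(i in `I_n) [set w : seqR R | w i <= c]).
  apply: bigcap_measurableType => i _; apply: sub_gen_smallest.
  exists i, `]-oo, c]%classic; split; first exact: measurable_itv.
  by apply/seteqP; split => u /=; rewrite in_itv.
by apply/seteqP; split => u /=.
Qed.

(** The bound on the first [n] coordinates alone has probability [c ^+ n], which tends to 0. *)
Lemma bounded_sequences_null (m : probability (seqR R) R) (c : R) :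
  is_product_lebesgue01 m -> 0 <= c < 1 ->
  m.-negligible [set w : seqR R | forall i, w i <= c].
Proof.
move=> hm /andP[c0 c1].
pose A n : set (seqR R) := [set w : seqR R | forall i, (i < n)%N -> w i <= c].
have mA n : measurable (A n) by exact: bounded_coordinates_measurable.
have muA n : m (A n) = (c ^+ n)%:E.
  have := hm n (fun=> `]-oo, c]%classic) (fun=> measurable_itv _).
  rewrite (_ : [set w | _] = A n); last first.
    by apply/seteqP; split => u /= h i /h; rewrite in_itv.
  rewrite (_ : `]-oo, c] `&` `]0, 1[ = `]0, c])%classic; last first.
    apply/seteqP; split => x /=; rewrite !in_itv/=.
      by move=> [-> /andP[-> _]].
    by move=> /andP[-> xc]; rewrite xc; split => //; exact: le_lt_trans c1.
  move=> ->; rewrite big_const card_ord.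
  have -> : lebesgue_measure (`]0, c]%classic : set R) = c%:E.
    rewrite lebesgue_measure_itv/= lte_fin -EFinB subr0; case: ltP => // c0'.
    by rewrite (@le_anti _ _ c 0) ?c0 ?c0'.
  elim: n => [|n IH]; first by rewrite /= expr0.
  by rewrite iterS IH -EFinM exprS.
exists (\bigcap_n A n); split.
- by apply: bigcap_measurableType => n _; exact: mA.
- apply/eqP; rewrite eq_le measure_ge0 andbT; apply/lee_addgt0Pr => e e0.
  rewrite add0e.
  have [n cn] : exists n, c ^+ n < e.
    have [->|cn0] := eqVneq c 0; first by exists 1%N; rewrite expr1.
    have cp : 0 < c by rewrite lt_neqAle eq_sym cn0.
    have [n nP] := @expr_unbounded R c^-1 e^-1 ltac:(by rewrite invf_gt1).
    by exists n; move: nP; rewrite exprVn ltf_pV2 ?posrE ?exprn_gt0.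
  apply: (@le_trans _ _ (m (A n))); last by rewrite muA lee_fin ltW.
  apply: le_measure; rewrite ?inE//; last exact: bigcap_inf.
  by apply: bigcap_measurableType => i _; exact: mA.
- by move=> u /= uc n _ i _; exact: uc.
Qed.

End Final.

Theorem theorem3 (R : realType) (m : probability (seqR R) R)
    (hm : is_product_lebesgue01 m) (w : nat -> R) (hw : @Omega_b R w) :
  m.-negligible (moduli_space w).
Proof.
(* The thresholds [1 - j.+1%:R^-1] are nonnegative and exceed any given [c < 1] eventually, so
   countably many null sets suffice. *)
apply: (@negligibleS _ _ _ m
  (\bigcup_j [set u : seqR R | forall i, u i <= 1 - j.+1%:R^-1])).
  move=> u /(moduli_space_bounded_away hw)[c c1 uc].
  exists (Num.bound (1 - c)^-1) => //= i; apply: le_trans (uc i) _.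
  rewrite lerBrDl -lerBrDr invf_ple ?posrE ?subr_gt0//.
  apply: ltW; apply: lt_trans (archi_boundP _) _; last by rewrite ltr_nat.
  by rewrite invr_ge0 subr_ge0 ltW.
apply: negligible_bigcup => j; apply: bounded_sequences_null => //.
rewrite subr_ge0 invf_le1 ?ler1n//= ltrBlDr ltrDl invr_gt0.
Qed.
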